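(* Assume that the piecewise smooth system $(X_1,X_2,X_3,X_4)$ admits a sliding vector field on $\Lambda$ at $(x,0,0)$, corresponding to $(\psi_*,\phi_* )\in(-1,1)^2$ with $\tilde F_x(\psi_*,\phi_* )=(0,0)$, which is of node/focus type, and assume further that the differences $$\beta_1-\beta_2,\quad \beta_4-\beta_3,\quad \gamma_1-\gamma_4,\quad \gamma_2-\gamma_3$$ are of the same sign. If these differences are positive, then the sliding vector field is repelling, while if these differences are negative, then the sliding vector field is attracting.
   Context: Setting. Let $\mathcal U\subset\mathbb R^3$ with coordinates $(x,y,z)$, $\mathcal I$ an interval, $\Lambda=\{(x,0,0):x\in\mathcal I\}$, $\mathcal Q_1=\{y\ge0,z\ge0\}$, $\mathcal Q_2=\{y\le0,z\ge0\}$, $\mathcal Q_3=\{y\le0,z\le0\}$, $\mathcal Q_4=\{y\ge0,z\le0\}$. The piecewise smooth system is $(\dot x,\dot y,\dot z)^T=X_i$ on $\mathcal Q_i$ with smooth $X_i=(\alpha_i,\beta_i,\gamma_i)^T$; standing assumption: $\alpha_i,\beta_i,\gamma_i$ depend only on $x$ (evaluated at the fixed $x$). Put $\tilde X_i=(\beta_i,\gamma_i)^T$ and for $(\psi,\phi)\in(-1,1)^2$ let $$\tilde F_x(\psi,\phi)=\tfrac12\Big(\tfrac{\tilde X_1}{2}(1+\phi)+\tfrac{\tilde X_4}{2}(1-\phi)\Big)(1+\psi)+\tfrac12\Big(\tfrac{\tilde X_2}{2}(1+\phi)+\tfrac{\tilde X_3}{2}(1-\phi)\Big)(1-\psi).$$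 Sliding. A sliding vector field on $\Lambda$ is a convex combination $\nu_1X_1+\nu_2X_2+\nu_3X_3+\nu_4X_4$ (with $\sum_i\nu_i=1$) tangent to $\Lambda$; in the paper these are given by the zeros $(\psi_*,\phi_* )\in(-1,1)^2$ of $\tilde F_x$ through $\nu_1=\sigma_\psi\sigma_\phi$, $\nu_2=(1-\sigma_\psi)\sigma_\phi$, $\nu_3=(1-\sigma_\psi)(1-\sigma_\phi)$, $\nu_4=\sigma_\psi(1-\sigma_\phi)$, with $\sigma_\psi=(1+\psi_* )/2$, $\sigma_\phi=(1+\phi_* )/2$. Stability. Let $\psi,\phi:\mathbb R\to[-1,1]$ be any regularization functions: smooth ($C^k$, $k\ge1$), with positive derivative wherever the value lies in $(-1,1)$, tending to $\pm1$ at $\pm\infty$, and with $r\mapsto\psi(r^{-1}),\phi(r^{-1})$ extending smoothly to $r=0$ from either side. Put $\hat y_*=\psi^{-1}(\psi_* )$, $\hat z_*=\phi^{-1}(\phi_* )$ and $\mathbf J=\mathbf D\tilde F_x(\psi_*,\phi_* )\,\mathrm{diag}(\psi'(\hat y_* ),\phi'(\hat z_* ))$, the Jacobian of the layer problem $(\hat y',\hat z')^T=\tilde F_x(\psi(\hat y),\phi(\hat z))$ at $(\hat y_*,\hat z_* )$. The sliding vector field is of node/focus type if $\det\mathbf D\tilde F_x(\psi_*,\phi_* )>0$ (equivalently $\det\mathbf J>0$), and attracting (repelling) if both eigenvalues of $\mathbf J$ have negative (positive) real part. *)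

(* Defs.v *)
(* MathComp-Analysis over an arbitrary [R : realType]. *)
From HB Require Import structures.
From mathcomp Require Import all_boot all_order all_algebra.
From mathcomp Require Import all_classical all_reals all_analysis.
From mathcomp Require Import complex ring lra.

Set Implicit Arguments.
Unset Strict Implicit.
Unset Printing Implicit Defensive.

Import Order.TTheory GRing.Theory Num.Theory.
Import numFieldNormedType.Exports.

Local Open Scope classical_set_scope.
Local Open Scope ring_scope.

(* Intended for an open set [U] and finite-dimensional [V], where asking for
   continuous directional derivatives in all directions is asking for
   continuous partial derivatives. *)
Fixpoint class_C (R : realType) (V W : normedModType R) (k : nat)
    (U : set V) (f : V -> W) : Prop :=
  (forall p, U p -> {for p, continuous f}) /\
  match k with
  | 0%N => True
  | k'.+1 => forall v : V,
      (forall p, U p -> derivable f p v) /\ class_C k' U ('D_v f)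
  end.

Definition quadrant1 (R : realType) : set 'rV[R]_3 :=
  [set p | 0 <= p 0 1 /\ 0 <= p 0 2].
Definition quadrant2 (R : realType) : set 'rV[R]_3 :=
  [set p | p 0 1 <= 0 /\ 0 <= p 0 2].
Definition quadrant3 (R : realType) : set 'rV[R]_3 :=
  [set p | p 0 1 <= 0 /\ p 0 2 <= 0].
Definition quadrant4 (R : realType) : set 'rV[R]_3 :=
  [set p | 0 <= p 0 1 /\ p 0 2 <= 0].

Definition axis_point (R : realType) (x : R) : 'rV[R]_3 :=
  \row_(j < 3) (if j == 0 then x else 0).

(* A vector field on the closed set [Q] is represented by a total function; it
   is C^k when it coincides on [Q] with a field that is C^k near [Q]. *)
Definition smooth_field (R : realType) (k : nat) (Q : set 'rV[R]_3)
    (X : 'rV[R]_3 -> 'rV[R]_3) : Prop :=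
  exists (V : set 'rV[R]_3) (Y : 'rV[R]_3 -> 'rV[R]_3),
    [/\ open V, Q `<=` V, class_C k V Y & forall p, Q p -> X p = Y p].

Definition depends_only_on_x (R : realType) (Q : set 'rV[R]_3)
    (X : 'rV[R]_3 -> 'rV[R]_3) : Prop :=
  forall p q, Q p -> Q q -> p 0 0 = q 0 0 -> X p = X q.

Record pws_system (R : realType) (k : nat) := PwsSystem {
  domain : set 'rV[R]_3;
  base : interval R;
  X1 : 'rV[R]_3 -> 'rV[R]_3;
  X2 : 'rV[R]_3 -> 'rV[R]_3;
  X3 : 'rV[R]_3 -> 'rV[R]_3;
  X4 : 'rV[R]_3 -> 'rV[R]_3;
  domain_open : open domain;
  axis_in_domain : forall x, x \in base -> domain (axis_point x);
  X1_smooth : smooth_field k (domain `&` @quadrant1 R) X1;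
  X2_smooth : smooth_field k (domain `&` @quadrant2 R) X2;
  X3_smooth : smooth_field k (domain `&` @quadrant3 R) X3;
  X4_smooth : smooth_field k (domain `&` @quadrant4 R) X4;
  X1_only_x : depends_only_on_x (domain `&` @quadrant1 R) X1;
  X2_only_x : depends_only_on_x (domain `&` @quadrant2 R) X2;
  X3_only_x : depends_only_on_x (domain `&` @quadrant3 R) X3;
  X4_only_x : depends_only_on_x (domain `&` @quadrant4 R) X4
}.

Definition beta (R : realType) (X : 'rV[R]_3 -> 'rV[R]_3) (x : R) : R :=
  X (axis_point x) 0 1.
Definition gamma (R : realType) (X : 'rV[R]_3 -> 'rV[R]_3) (x : R) : R :=
  X (axis_point x) 0 2.

Definition Xtilde (R : realType) (X : 'rV[R]_3 -> 'rV[R]_3) (x : R) :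
    'rV[R]_2 :=
  \row_(j < 2) (if j == 0 then beta X x else gamma X x).

(* The argument [s] is the row vector (psi, phi). *)
Definition Ftilde (R : realType) (k : nat) (S : pws_system R k) (x : R)
    (s : 'rV[R]_2) : 'rV[R]_2 :=
  let psi := s 0 0 in let phi := s 0 1 in
  ((1 + psi) / 2) *: (((1 + phi) / 2) *: Xtilde (X1 S) x
                      + ((1 - phi) / 2) *: Xtilde (X4 S) x)
  + ((1 - psi) / 2) *: (((1 + phi) / 2) *: Xtilde (X2 S) x
                        + ((1 - phi) / 2) *: Xtilde (X3 S) x).

(* [jacobian] acts on row vectors, hence the transpose: the (i, j) entry of
   [DFtilde] is the derivative of component i in variable j. *)
Definition DFtilde (R : realType) (k : nat) (S : pws_system R k) (x : R)
    (s : 'rV[R]_2) : 'M[R]_2 :=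
  (jacobian (Ftilde S x) s)^T.

Definition open_square (R : realType) : set 'rV[R]_2 :=
  [set s | -1 < s 0 0 < 1 /\ -1 < s 0 1 < 1].

Definition sliding_field (R : realType) (k : nat) (S : pws_system R k) (x : R)
    (s : 'rV[R]_2) : 'rV[R]_3 :=
  let sigma_psi := (1 + s 0 0) / 2 in
  let sigma_phi := (1 + s 0 1) / 2 in
  (sigma_psi * sigma_phi) *: X1 S (axis_point x)
  + ((1 - sigma_psi) * sigma_phi) *: X2 S (axis_point x)
  + ((1 - sigma_psi) * (1 - sigma_phi)) *: X3 S (axis_point x)
  + (sigma_psi * (1 - sigma_phi)) *: X4 S (axis_point x).

Definition tangent_to_axis (R : realType) (v : 'rV[R]_3) : Prop :=
  v 0 1 = 0 /\ v 0 2 = 0.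

Definition admits_sliding (R : realType) (k : nat) (S : pws_system R k)
    (x : R) (s : 'rV[R]_2) : Prop :=
  open_square s /\ tangent_to_axis (sliding_field S x s).

Lemma sliding_field_tangentP (R : realType) (k : nat) (S : pws_system R k)
    (x : R) (s : 'rV[R]_2) :
  tangent_to_axis (sliding_field S x s) <-> Ftilde S x s = 0.
Proof.
have E0 : Ftilde S x s 0 0 = sliding_field S x s 0 1.
  by rewrite /Ftilde /sliding_field /Xtilde /beta !mxE /=; field.
have E1 : Ftilde S x s 0 1 = sliding_field S x s 0 2.
  by rewrite /Ftilde /sliding_field /Xtilde /gamma !mxE /=; field.
split=> [[h1 h2]|h]; last by rewrite /tangent_to_axis -E0 -E1 h !mxE.
apply/rowP => j; rewrite [RHS]mxE; case: (unliftP 0 j) => [i|] ->.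
  by rewrite ord1 -h2 -E1; congr (Ftilde S x s 0 _); apply/val_inj.
by rewrite -h1 -E0.
Qed.

Definition node_focus (R : realType) (k : nat) (S : pws_system R k) (x : R)
    (s : 'rV[R]_2) : Prop :=
  0 < \det (DFtilde S x s).

(* One-sided C^k extendability at 0 of r |-> psi (r^-1) is expressed by a C^k
   function on the line that agrees with it on that side. *)
Record regularization (R : realType) (k : nat) (psi : R -> R) : Prop :=
  Regularization {
  reg_range : forall u, -1 <= psi u <= 1;
  reg_smooth : class_C k setT psi;
  reg_increasing : forall u, -1 < psi u < 1 -> 0 < derive1 psi u;
  reg_pinfty : psi u @[u --> +oo] --> (1 : R);
  reg_ninfty : psi u @[u --> -oo] --> (-1 : R);
  reg_right : exists g : R -> R,
    class_C k setT g /\ forall r, 0 < r -> g r = psi r^-1;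
  reg_left : exists g : R -> R,
    class_C k setT g /\ forall r, r < 0 -> g r = psi r^-1
}.

Definition reg_inv (R : realType) (psi : R -> R) (v : R) : R :=
  xget 0 [set u | psi u = v].

Lemma reg_invK (R : realType) (k : nat) (psi : R -> R) (v : R) :
  regularization k psi -> -1 < v < 1 -> psi (reg_inv psi v) = v.
Proof.
move=> [_ + _ hp hn _ _] /andP[v1 v2].
move=> smooth; have {smooth} cpsi u : {for u, continuous psi}.
  by case: k smooth => [|m] [+ _]; exact.
have [b [b0 hb]] : exists b, 0 < b /\ v <= psi b.
  have : \forall u \near +oo, v <= psi u by apply: (cvgr_ge 1 hp).
  move=> near_v; suff: \forall u \near +oo, 0 < u /\ v <= psi u.
    by move/filter_ex => [b hb]; exists b.
  by near=> u; split; near: u => //; apply: nbhs_pinfty_gt; rewrite num_real.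
have [a [a0 ha]] : exists a, a < 0 /\ psi a <= v.
  have : \forall u \near -oo, psi u <= v by apply: (cvgr_le (-1) hn).
  move=> near_v; suff: \forall u \near -oo, u < 0 /\ psi u <= v.
    by move/filter_ex => [a ha]; exists a.
  by near=> u; split; near: u => //; apply: nbhs_ninfty_lt; rewrite num_real.
have [| |c _ hc] := @IVT R psi a b v (ltW (lt_trans a0 b0)).
- by apply: continuous_subspaceT => u; apply: cpsi.
- by rewrite ge_min le_max ha hb orbT.
by rewrite /reg_inv; case: xgetP => [y _ //|/(_ c)].
Unshelve. all: by end_near. Qed.

Definition layer_jacobian (R : realType) (k : nat) (S : pws_system R k)
    (psi phi : R -> R) (x : R) (s : 'rV[R]_2) : 'M[R]_2 :=
  DFtilde S x s *m
  diag_mx (\row_(j < 2) (if j == 0 then derive1 psi (reg_inv psi (s 0 0))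
                         else derive1 phi (reg_inv phi (s 0 1)))).

Definition complex_eigenvalue (R : realType) (n : nat) (A : 'M[R]_n)
    (lam : R[i]) : Prop :=
  eigenvalue (map_mx (real_complex R) A) lam.

Definition attracting (R : realType) (k : nat) (S : pws_system R k)
    (psi phi : R -> R) (x : R) (s : 'rV[R]_2) : Prop :=
  forall lam : R[i], complex_eigenvalue (layer_jacobian S psi phi x s) lam ->
    complex.Re lam < 0.

Definition repelling (R : realType) (k : nat) (S : pws_system R k)
    (psi phi : R -> R) (x : R) (s : 'rV[R]_2) : Prop :=
  forall lam : R[i], complex_eigenvalue (layer_jacobian S psi phi x s) lam ->
    0 < complex.Re lam.

Definition differences (R : realType) (k : nat) (S : pws_system R k) (x : R) :
    seq R :=
  [:: beta (X1 S) x - beta (X2 S) x; beta (X4 S) x - beta (X3 S) x;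
      gamma (X1 S) x - gamma (X4 S) x; gamma (X2 S) x - gamma (X3 S) x].

Definition all_positive (R : realType) (ds : seq R) : Prop :=
  forall d, d \in ds -> 0 < d.

Definition all_negative (R : realType) (ds : seq R) : Prop :=
  forall d, d \in ds -> d < 0.

(* Main.v *)
(* On the open square the diagonal entries of the Jacobian of [Ftilde] are half
   convex combinations of the four differences, so the trace of [J] inherits
   their common sign, while [det J > 0] by the node/focus assumption.  For a real
   2x2 matrix with positive determinant the trace and the real parts of the
   eigenvalues have the same sign. *)
Require Import Defs.
From HB Require Import structures.
From mathcomp Require Import all_boot all_order all_algebra.
From mathcomp Require Import all_classical all_reals all_analysis.
From mathcomp Require complex.
From mathcomp Require Import ring lra.
Import Order.TTheory GRing.Theory Num.Theory.
Import numFieldNormedType.Exports.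
Local Open Scope ring_scope.

Lemma det_mx2 (A : comPzRingType) (M : 'M[A]_2) :
  \det M = M 0 0 * M 1 1 - M 0 1 * M 1 0.
Proof.
have l0 : lift (0 : 'I_2) 0 = 1 by apply/val_inj.
have l1 : lift (1 : 'I_2) 0 = 0 by apply/val_inj.
rewrite (expand_det_row _ 0) !big_ord_recl big_ord0 /cofactor !det_mx11 !mxE.
by rewrite /= ?l0 ?l1 /= addn0 expr0 expr1; ring.
Qed.

Lemma eigenvalue_mx2 (F : fieldType) (M : 'M[F]_2) (a : F) :
  eigenvalue M a ->
  a ^+ 2 - (M 0 0 + M 1 1) * a + (M 0 0 * M 1 1 - M 0 1 * M 1 0) = 0.
Proof.
rewrite eigenvalue_root_char /root /char_poly det_mx2 !mxE /= => /eqP.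
by rewrite !hornerE /= => <-; ring.
Qed.

(** Write T and D for trace and determinant and split the characteristic equation at u + iv into
    real and imaginary parts. Either v = 0 and T u = u^2 + D, or u = T / 2 and T u = T^2 / 2.
    Stating the sign of the product serves both the attracting and the repelling case. *)
Lemma mx2_trace_eigenvalue_gt0 (R : realType) (M : 'M[R]_2)
    (lam : complex.complex R) :
  0 < M 0 0 * M 1 1 - M 0 1 * M 1 0 -> M 0 0 + M 1 1 != 0 ->
  complex_eigenvalue M lam -> 0 < (M 0 0 + M 1 1) * complex.Re lam.
Proof.
move=> D0 T0 /eigenvalue_mx2; rewrite !mxE.
case: lam => u v /eqP; rewrite complex.eq_complex /= => /andP[/eqP re /eqP im].
(* The imaginary part factors, which separates real eigenvalues from conjugate pairs. *)
have : v * (2 * u - (M 0 0 + M 1 1)) = 0 by rewrite -[RHS]im; ring.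
move/eqP; rewrite mulf_eq0 => /orP[/eqP v0|/eqP uE].
  rewrite v0 in re.
  suff -> : (M 0 0 + M 1 1) * u
      = u ^+ 2 + (M 0 0 * M 1 1 - M 0 1 * M 1 0) by rewrite ltr_wpDl ?sqr_ge0.
  by apply/eqP; rewrite -subr_eq0 -oppr_eq0 -[X in _ == X]re; apply/eqP; ring.
have -> : u = (M 0 0 + M 1 1) / 2 by lra.
by rewrite mulrA divr_gt0 // -expr2 exprn_even_gt0.
Qed.

(** The difference quotient equals [w] for every nonzero [h]. This suits [Ftilde], which is affine
    along each coordinate direction. *)
Lemma derive_affine (R : realType) (V W : normedModType R) (f : V -> W)
    (a v : V) (w : W) :
  (forall h : R, f (h *: v + a) = f a + h *: w) -> 'D_v f a = w.
Proof.
move=> fE; apply: cvg_lim; first exact: norm_hausdorff.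
apply: (@cvg_trans _ ((fun=> w) @ (0 : R)^')%classic); last exact: cvg_cst.
apply: near_eq_cvg; near=> h.
rewrite /= fE addrAC subrr add0r scalerA mulVf ?scale1r //.
by near: h; exact: nbhs_dnbhs_neq.
Unshelve. all: by end_near. Qed.

Lemma convex_comb_gt0 (R : realType) (a d e : R) :
  -1 < a < 1 -> 0 < d -> 0 < e -> 0 < (1 + a) / 2 * d + (1 - a) / 2 * e.
Proof.
move=> /andP[a0 a1] d0 e0.
by apply: addr_gt0; rewrite mulr_gt0 // divr_gt0 //; lra.
Qed.

(** The expression has the shape of the trace of the layer Jacobian, with [p] and [q] standing for
    the slopes of the two regularizations. *)
Lemma scaled_trace_gt0 {R : realType} {a b p q d1 d2 d3 d4 : R} :
  -1 < a < 1 -> -1 < b < 1 -> 0 < p -> 0 < q ->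
  0 < d1 -> 0 < d2 -> 0 < d3 -> 0 < d4 ->
  0 < 2^-1 * ((1 + b) / 2 * d1 + (1 - b) / 2 * d2) * p
      + 2^-1 * ((1 + a) / 2 * d3 + (1 - a) / 2 * d4) * q.
Proof.
move=> ha hb p0 q0 d10 d20 d30 d40.
by apply: addr_gt0; rewrite mulr_gt0 // mulr_gt0 // ?invr_gt0 // convex_comb_gt0.
Qed.

Section SlidingJacobian.
Variables (R : realType) (k : nat) (S : pws_system R k) (x : R).
Variable (s : 'rV[R]_2).

Lemma Ftilde_differentiable : differentiable (Ftilde S x) s.
Proof.
have d0 := differentiable_coord s 0 0; have d1 := differentiable_coord s 0 1.
have half (f : 'rV[R]_2 -> R) (c : R) : differentiable f s ->
    differentiable (fun z => (1 + c * f z) / 2) s.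
  move=> df; apply: differentiableM => //.
  by apply: differentiableD => //; apply: differentiableM.
(* The signs [c] and [d] select a quadrant, and [g c d] is the weight of its field in [Ftilde]. *)
pose g (c d : R) (z : 'rV[R]_2) := (1 + c * z 0 0) / 2 * ((1 + d * z 0 1) / 2).
have dg c d : differentiable (g c d) s by apply: differentiableM; apply: half.
have -> : Ftilde S x = (fun z => g 1 1 z *: Xtilde (X1 S) x)
    + (fun z => g 1 (-1) z *: Xtilde (X4 S) x)
    + (fun z => g (-1) 1 z *: Xtilde (X2 S) x)
    + (fun z => g (-1) (-1) z *: Xtilde (X3 S) x).
  by apply/funext => z; apply/rowP => j; rewrite !fctE /Ftilde !mxE /g; ring.
by do 3?[apply: differentiableD]; apply: differentiableZl.
Qed.

(** Differentiability lets the entries of the Jacobian be read off as directional derivatives. *)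
Lemma DFtilde_derive (i j : 'I_2) :
  DFtilde S x s i j = ('D_(delta_mx 0 j) (Ftilde S x) s : 'rV[R]_2) 0 i.
Proof.
by rewrite (deriveEjacobian _ Ftilde_differentiable) -rowE !mxE.
Qed.

(** For fixed phi, [Ftilde] is affine in psi; its slope averages the jumps of the field across y =
    0. *)
Lemma DFtilde00 : DFtilde S x s 0 0 =
  2^-1 * ((1 + s 0 1) / 2 * (beta (X1 S) x - beta (X2 S) x)
          + (1 - s 0 1) / 2 * (beta (X4 S) x - beta (X3 S) x)).
Proof.
rewrite DFtilde_derive (@derive_affine _ _ _ _ _ _
  (2^-1 *: (((1 + s 0 1) / 2) *: (Xtilde (X1 S) x - Xtilde (X2 S) x)
          + ((1 - s 0 1) / 2) *: (Xtilde (X4 S) x - Xtilde (X3 S) x)))).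
  by rewrite !mxE.
by move=> h; apply/rowP => j; rewrite /Ftilde !mxE /=; ring.
Qed.

Lemma DFtilde11 : DFtilde S x s 1 1 =
  2^-1 * ((1 + s 0 0) / 2 * (gamma (X1 S) x - gamma (X4 S) x)
          + (1 - s 0 0) / 2 * (gamma (X2 S) x - gamma (X3 S) x)).
Proof.
rewrite DFtilde_derive (@derive_affine _ _ _ _ _ _
  (2^-1 *: (((1 + s 0 0) / 2) *: (Xtilde (X1 S) x - Xtilde (X4 S) x)
          + ((1 - s 0 0) / 2) *: (Xtilde (X2 S) x - Xtilde (X3 S) x)))).
  by rewrite !mxE.
by move=> h; apply/rowP => j; rewrite /Ftilde !mxE /=; ring.
Qed.

End SlidingJacobian.

Theorem corollary2 (R : realType) (k : nat) (hk : (1 <= k)%N)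
    (S : pws_system R k) (x : R) (hx : x \in base S) (s : 'rV[R]_2)
    (hslide : admits_sliding S x s) (hF : Ftilde S x s = 0)
    (hnode : node_focus S x s)
    (hsign : all_positive (differences S x) \/ all_negative (differences S x))
    (psi phi : R -> R)
    (hpsi : regularization k psi) (hphi : regularization k phi) :
  (all_positive (differences S x) -> repelling S psi phi x s) /\
  (all_negative (differences S x) -> attracting S psi phi x s).
Proof.
have [[s0 s1] _] := hslide.
(* [reg_inv] returns a true preimage of a value in (-1, 1), where the regularization has positive
   slope. *)
have p0 : 0 < derive1 psi (reg_inv psi (s 0 0)).
  by apply: (reg_increasing hpsi); rewrite (reg_invK hpsi).
have q0 : 0 < derive1 phi (reg_inv phi (s 0 1)).
  by apply: (reg_increasing hphi); rewrite (reg_invK hphi).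
have JE (i j : 'I_2) : layer_jacobian S psi phi x s i j = DFtilde S x s i j *
    (if j == 0 then derive1 psi (reg_inv psi (s 0 0))
     else derive1 phi (reg_inv phi (s 0 1))).
  by rewrite /layer_jacobian mul_mx_diag !mxE.
have detJ : 0 < layer_jacobian S psi phi x s 0 0 * layer_jacobian S psi phi x s 1 1
    - layer_jacobian S psi phi x s 0 1 * layer_jacobian S psi phi x s 1 0.
  move: hnode; rewrite /node_focus det_mx2 !JE /= => D0.
  (* Column scaling multiplies the determinant by the product of the two slopes. *)
  rewrite [ltRHS](_ : _ = (DFtilde S x s 0 0 * DFtilde S x s 1 1
    - DFtilde S x s 0 1 * DFtilde S x s 1 0) *
    (derive1 psi (reg_inv psi (s 0 0)) * derive1 phi (reg_inv phi (s 0 1)))).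
    by rewrite mulr_gt0 // mulr_gt0.
  by ring.
have eig := @mx2_trace_eigenvalue_gt0 _ _ _ detJ.
have diff_in n : (n < 4)%N -> nth 0 (differences S x) n \in differences S x.
  by move=> n4; apply: mem_nth.
split=> sgn lam /eig; rewrite !JE /= DFtilde00 DFtilde11.
- have /= d0 := sgn _ (diff_in 0%N isT); have /= d1 := sgn _ (diff_in 1%N isT).
  have /= d2 := sgn _ (diff_in 2%N isT); have /= d3 := sgn _ (diff_in 3%N isT).
  have T0 := scaled_trace_gt0 s0 s1 p0 q0 d0 d1 d2 d3.
  by move=> /(_ (lt0r_neq0 T0)); rewrite pmulr_rgt0.
- have /= d0 := sgn _ (diff_in 0%N isT); have /= d1 := sgn _ (diff_in 1%N isT).
  have /= d2 := sgn _ (diff_in 2%N isT); have /= d3 := sgn _ (diff_in 3%N isT).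
  (* The positive case is applied to the negated differences; pulling the signs out makes the trace
     negative. *)
  rewrite -oppr_gt0 in d0; rewrite -oppr_gt0 in d1.
  rewrite -oppr_gt0 in d2; rewrite -oppr_gt0 in d3.
  have := scaled_trace_gt0 s0 s1 p0 q0 d0 d1 d2 d3.
  rewrite !mulrN -!opprD !(mulrN, mulNr) -opprD oppr_gt0 => T0.
  by move=> /(_ (ltr0_neq0 T0)); rewrite nmulr_rgt0.
Qed.
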